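(* Let $n>1$ be an integer and $a>0$, and consider the polynomial regression model of degree $n$ with no intercept on the interval $[0,a]$, that is, the model with vector of regression functions $f(x)=(x,x^2,\dots,x^n)^\top$, $x\in[0,a]$. Let $$s_i=a\cdot\frac{\cos\frac{(n-i)\pi}{n}+\cos\frac{\pi}{2n}}{1+\cos\frac{\pi}{2n}},\qquad i=1,\dots,n,$$ so that $s_1<s_2<\cdots<s_n$, let $$\bar L_i(z)=\frac{z\prod_{j\neq i}(z-s_j)}{s_i\prod_{j\neq i}(s_i-s_j)},\qquad i=1,\dots,n,$$ with derivative $\bar L_i'$, and define $$\omega_i(z)=\frac{|\bar L_i'(z)|}{\sum_{j=1}^n|\bar L_j'(z)|},\qquad i=1,\dots,n,\ z\in\mathbb{R}.$$ For $i=1,\dots,n$ and $k=1,\dots,n-1$ let $\omega_{i,k}$ denote the $k$-th root (in increasing order) of the function $\omega_i(z)$, and put $\omega_{1,0}=-\infty$, $\omega_{n,n}=\infty$. Let $z\in\mathbb{R}$. Then the optimal design $\xi^*(z)$ for estimating the slope of this model at the point $z$ is supported at the points $s_1,\dots,s_n$ (i.e. its set of support points is exactly $\{s_1,\dots,s_n\}$) if and only if $$z\in\bigcup_{i=1}^n(\omega_{1,i-1},\omega_{n,i}).$$ Moreover, in this case the weight of the design $\xi^*(z)$ at $s_i$ is given by $\omega_i(z)$, $i=1,\dots,n$.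
   Context: The model is $Y_i=f^\top(x_i)\theta+\varepsilon_i$, $i=1,\dots,N$, with $f(x)=(x,x^2,\dots,x^n)^\top$, unknown parameter $\theta\in\mathbb{R}^n$, independent errors with mean $0$ and variance $\sigma^2>0$, and $x_i\in[0,a]$. An (approximate) design $\xi$ on $[0,a]$ is a discrete probability measure with finitely many distinct support points $x_1,\dots,x_m\in[0,a]$ and positive weights $w_1,\dots,w_m$ summing to $1$. Its information matrix is $M(\xi)=\int_{[0,a]}f(x)f^\top(x)\,\xi(dx)=\sum_{l=1}^m w_l f(x_l)f^\top(x_l)$. For a vector $c\in\mathbb{R}^n$, a design is called $c$-optimal if it minimizes, over all designs on $[0,a]$, the function $$\Phi(\xi)=\begin{cases}c^\top M^-(\xi)c,&\text{if there exists } v\in\mathbb{R}^n\text{ with } c=M(\xi)v,\\ \infty,&\text{otherwise,}\end{cases}$$ where $M^-(\xi)$ is a generalized inverse of $M(\xi)$ (in the first case the value $c^\top M^-(\xi)c$ does not depend on the choice of generalized inverse). The optimal design for estimating the slope (equivalently, the derivative $\frac{d}{dx}f^\top(x)\theta\big|_{x=z}$) at the point $z$ is the $c$-optimal design for $c=f'(z)=(1,2z,\dots,nz^{n-1})^\top$. The points $s_1<\cdots<s_n$ are exactly the extremal points on $[0,a]$ (the points where the absolute value equals $1$) of the polynomial $S_n(x)=T_n\bigl(\frac{x}{a}(1+\cos\frac{\pi}{2n})-\cos\frac{\pi}{2n}\bigr)$, where $T_n(x)=\cos(n\arccos x)$ is the $n$-th Chebyshev polynomial of the first kind. The polynomials $\bar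 L_i$ are the Lagrange basis interpolation polynomials without intercept for the nodes $s_1,\dots,s_n$; each $\bar L_i'$ has exactly $n-1$ distinct real roots, and these are the roots of $\omega_i(z)$. *)

(* Defs.v *)
From mathcomp Require Import all_boot all_order all_algebra finmap.
From mathcomp Require Import all_classical all_reals all_analysis.

Set Implicit Arguments.
Unset Strict Implicit.
Unset Printing Implicit Defensive.

Import Order.TTheory GRing.Theory Num.Theory.
Local Open Scope classical_set_scope.
Local Open Scope ring_scope.

Section Designs.
Variables (R : realType) (n : nat) (a : R).

Definition regression_vector (x : R) : 'cV[R]_n := \col_(i < n) x ^+ i.+1.

Definition slope_vector (z : R) : 'cV[R]_n :=
  \col_(i < n) (i.+1%:R * z ^+ i).

(* [xi x] is the weight at [x]; the support points are [finsupp xi]. *)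
Definition is_design (xi : {fsfun R -> R with 0}) : Prop :=
  (forall x, x \in finsupp xi -> 0 <= x <= a /\ 0 < xi x) /\
  \sum_(x <- finsupp xi) xi x = 1.

Definition information_matrix (xi : {fsfun R -> R with 0}) : 'M[R]_n :=
  \sum_(x <- finsupp xi)
    xi x *: (regression_vector x *m (regression_vector x)^T).

(* [pinvmx M] is a generalized inverse of [M]; by [quadratic_form_ginv] below
   any other one gives the same value on the range of [M]. *)
Definition c_criterion (c : 'cV[R]_n) (xi : {fsfun R -> R with 0}) : \bar R :=
  let M := information_matrix xi in
  if `[< exists v : 'cV[R]_n, c = M *m v >]
  then ((c^T *m pinvmx M *m c) 0 0)%:E
  else +oo%E.

Definition c_optimal (c : 'cV[R]_n) (xi : {fsfun R -> R with 0}) : Prop :=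
  is_design xi /\
  forall eta, is_design eta -> (c_criterion c xi <= c_criterion c eta)%E.

Definition slope_optimal (z : R) (xi : {fsfun R -> R with 0}) : Prop :=
  c_optimal (slope_vector z) xi.

End Designs.

Lemma pinvmx_ginv (F : fieldType) (m n : nat) (M : 'M[F]_(m, n)) :
  M *m pinvmx M *m M = M.
Proof. exact: mulmxKpV. Qed.

Lemma information_matrix_sym (R : realType) (n : nat)
    (xi : {fsfun R -> R with 0}) :
  (information_matrix n xi)^T = information_matrix n xi.
Proof.
rewrite /information_matrix raddf_sum; apply: eq_bigr => x _ /=.
by rewrite linearZ /= trmx_mul trmxK.
Qed.

Lemma quadratic_form_ginv (F : fieldType) (n : nat) (M G : 'M[F]_n)
    (c v : 'cV[F]_n) :
  M^T = M -> M *m G *m M = M -> c = M *m v ->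
  c^T *m G *m c = c^T *m pinvmx M *m c.
Proof.
move=> sM GM ->; rewrite trmx_mul sM.
have E (H : 'M[F]_n) : v^T *m M *m H *m (M *m v) = v^T *m (M *m H *m M) *m v.
  by rewrite !mulmxA.
by rewrite !E GM pinvmx_ginv.
Qed.

(* Nodes, interpolation polynomials and weights are indexed by 1, ..., n. *)
Section Nodes.
Variables (R : realType) (n : nat) (a : R).

Definition node (i : nat) : R :=
  a * ((cos ((n - i)%:R * pi / n%:R) + cos (pi / (2 * n%:R))) /
       (1 + cos (pi / (2 * n%:R)))).

Definition lagrange_no_intercept (i : nat) : {poly R} :=
  (node i * \prod_(1 <= j < n.+1 | j != i) (node i - node j))^-1 *:
  ('X * \prod_(1 <= j < n.+1 | j != i) ('X - (node j)%:P)).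

Definition omega (i : nat) (z : R) : R :=
  `|(lagrange_no_intercept i)^`().[z]| /
  \sum_(1 <= j < n.+1) `|(lagrange_no_intercept j)^`().[z]|.

End Nodes.

Lemma node_increasing (R : realType) (n : nat) (a : R) (i j : nat) :
  (0 < n)%N -> 0 < a -> (i < j <= n)%N -> node n a i < node n a j.
Proof.
move=> n0 a0 /andP[ij jn].
have nR : 0 < n%:R :> R by rewrite ltr0n.
have p0 : 0 < pi :> R := pi_gt0 R.
have c0 : 0 < 1 + cos (@pi R / (2 * n%:R)).
  apply: ltr_wpDr => //; apply: cos_ge0_pihalf.
  have h : 0 <= @pi R / (2 * n%:R) <= pi / 2.
    rewrite divr_ge0 ?mulr_ge0 ?(ltW p0) //=.
    rewrite ler_pM2l // lef_pV2 ?posrE ?mulr_gt0 //.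
    by rewrite ler_peMr // ler1n.
  move: h => /andP[h ->]; rewrite andbT; apply: le_trans h.
  by rewrite oppr_cp0; apply: divr_ge0 => //; exact: ltW.
have angle (k : nat) : (n - k)%:R * pi / n%:R \in `[0, @pi R].
  rewrite in_itv /= divr_ge0 ?mulr_ge0 ?(ltW p0) //=.
  by rewrite ler_pdivrMr // mulrC ler_pM2l // ler_nat leq_subr.
rewrite ltr_pM2l // ltr_pM2r ?invr_gt0 // ltrD2r ltr_cos ?angle //.
rewrite ltr_pM2r ?invr_gt0 // ltr_pM2r // ltr_nat.
by rewrite ltn_sub2l // (leq_trans ij).
Qed.

(* The [k]-th zero of [g] in increasing order, counting from 1: the zero with
   exactly [k - 1] smaller zeros (junk value 0 if there is none). *)
Definition kth_root (R : realType) (g : R -> R) (k : nat) : R :=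
  xget 0 [set x | g x = 0 /\ ([set y | g y = 0 /\ y < x] #= `I_(k.-1))%card].

Definition omega_root (R : realType) (n : nat) (a : R) (i k : nat) : \bar R :=
  if (i == 1)%N && (k == 0)%N then -oo%E
  else if (i == n) && (k == n) then +oo%E
  else (kth_root (omega n a i) k)%:E.

Definition node_support_region (R : realType) (n : nat) (a : R) : set R :=
  \bigcup_(i in [set i : nat | (1 <= i <= n)%N])
    [set z | (omega_root n a 1 i.-1 < z%:E < omega_root n a n i)%E].

(* Main.v *)
Require Import Defs.
From mathcomp Require Import all_boot all_order all_algebra finmap.
From mathcomp Require Import all_classical all_reals all_analysis.
From mathcomp Require Import polyrcf ring lra zify.
Import Order.TTheory GRing.Theory Num.Theory.
Set Implicit Arguments.
Unset Strict Implicit.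
Unset Printing Implicit Defensive.
Local Open Scope classical_set_scope.
Local Open Scope ring_scope.

(** Let L_i be the Lagrange polynomials without intercept, let S be the shifted
    Chebyshev polynomial, and for a design with finite criterion let h be the
    polynomial without intercept such that p'(z) is the integral of p h for every
    polynomial p of degree at most n without intercept; the criterion is then
    h'(z). If the numbers (-1)^(n-i) L_i'(z) are nonzero of one sign, then
    S'(z) = +-D with D = sum_i |L_i'(z)|, and expanding the integral of
    (h -+ D S)^2 >= 0 shows that D^2 is the least value of the criterion and is
    attained only by the weights |L_i'(z)| / D at the nodes, where S^2 = 1.
    Conversely, if an optimal design has all the nodes as its support, perturbing
    it shows that h^2 <= h'(z) on [0, a] with equality at the nodes; then h' and S'
    vanish at the interior nodes, so h is a multiple of S and the signs
    alternate. Finally, V. A. Markov's theorem on the interlacing of the critical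
    points of polynomials with interlacing roots identifies the set of z for which
    the signs alternate with the union of the intervals. *)

(** * Critical points of polynomials with real roots *)
Section Interlacing.
Variable R : rcfType.
Implicit Types (s t r b c : nat -> R) (p q : {poly R}).

Definition increasing_upto m (t : nat -> R) :=
  forall i j, (i < j < m)%N -> t i < t j.

Definition prod_roots m (t : nat -> R) : {poly R} :=
  \prod_(k < m) ('X - (t k)%:P).

Lemma horner_prod_roots m t x : (prod_roots m t).[x] = \prod_(k < m) (x - t k).
Proof. by rewrite horner_prod; apply: eq_bigr => k _; rewrite !hornerE. Qed.

Lemma horner_prod_roots_eq0 m t x :
  ((prod_roots m t).[x] == 0) = [exists k : 'I_m, x == t k].
Proof.
rewrite horner_prod_roots prodf_seq_eq0; apply/hasP/existsP => [[k _]|[k]].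
  by rewrite /= subr_eq0; exists k.
by move=> h; exists k; rewrite ?mem_index_enum //= subr_eq0.
Qed.

Lemma sign_prod_roots m t x : (prod_roots m t).[x] != 0 ->
  0 < (-1) ^+ (\sum_(k < m) (x < t k)%R)%N * (prod_roots m t).[x].
Proof.
rewrite horner_prod_roots_eq0 negb_exists => /forallP h.
rewrite horner_prod_roots -prodrXr -big_split /=; apply: prodr_gt0 => k _.
have := h k; rewrite neq_lt => /orP[] lt_xk; last first.
  by rewrite [x < _]ltNge ltW //= expr0 mul1r subr_gt0.
by rewrite lt_xk expr1 mulN1r oppr_gt0 subr_lt0.
Qed.

Lemma sign_prod_roots_between m t x k : (k <= m)%N ->
  (forall j, (j < k)%N -> t j < x) ->
  (forall j, (k <= j < m)%N -> x < t j) ->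
  0 < (-1) ^+ (m - k) * (prod_roots m t).[x].
Proof.
move=> km lo hi.
have -> : (m - k = \sum_(j < m) (x < t j)%R)%N.
  rewrite -(big_mkord xpredT (fun j => nat_of_bool (x < t j)%R)).
  rewrite (big_cat_nat (n := k)) //= big_nat_cond big1 ?add0n; last first.
    by move=> j /andP[/andP[_ jk] _]; rewrite ltNge ltW ?lo.
  rewrite big_nat_cond (eq_bigr (fun=> 1%N)); last first.
    by move=> j /andP[jk _]; rewrite hi.
  by rewrite -big_nat_cond sum_nat_const_nat muln1.
apply: sign_prod_roots; rewrite horner_prod_roots_eq0 negb_exists.
apply/forallP => j; case: (ltnP j k) => jk.
  by rewrite gt_eqF ?lo.
by rewrite lt_eqF ?hi ?jk /=.
Qed.

Lemma rolle_points m t : increasing_upto m.+1 t ->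
  exists r, forall k, (k < m)%N ->
    t k < r k < t k.+1 /\ (prod_roots m.+1 t)^`().[r k] = 0.
Proof.
move=> t_incr; pose p := prod_roots m.+1 t.
have ex k : {x | (k < m)%N -> t k < x < t k.+1 /\ p^`().[x] = 0}.
  case: (ltnP k m) => km; last by exists 0.
  have lt_t : t k < t k.+1 by apply: t_incr; rewrite ltnSn ltnS.
  have p0 j : (j < m.+1)%N -> p.[t j] = 0.
    move=> jm; apply/eqP; rewrite horner_prod_roots_eq0.
    by apply/existsP; exists (Ordinal jm).
  have [|x] := @poly_rolle _ _ _ p lt_t; first by rewrite !p0 // ltnW.
  by rewrite in_itv /= => xt px; exists x.
by exists (fun k => sval (ex k)) => k km; have := svalP (ex k) km.
Qed.

(** The [m] Rolle points are distinct zeros of a derivative of degree [m] with leading coefficient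
    [m+1], so they are all of its zeros. *)
Lemma deriv_prod_roots_factor m t r : increasing_upto m.+1 t ->
  (forall k, (k < m)%N ->
    t k < r k < t k.+1 /\ (prod_roots m.+1 t)^`().[r k] = 0) ->
  increasing_upto m r /\
  (prod_roots m.+1 t)^`() = m.+1%:R *: prod_roots m r.
Proof.
move=> t_incr rP.
have r_incr : increasing_upto m r.
  move=> i j /andP[ij jm]; have [/andP[_ ri] _] := rP i (ltn_trans ij jm).
  have [/andP[rj _] _] := rP j jm; apply: lt_trans ri (le_lt_trans _ rj).
  move: ij; rewrite leq_eqVlt => /predU1P[->//|ij]; apply/ltW/t_incr.
  by rewrite ij ltnS ltnW.
split=> //; set p := prod_roots _ t.
have size_p : size p = m.+2.
  rewrite /p /prod_roots -(big_mkord xpredT (fun k => 'X - (t k)%:P)).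
  by rewrite size_prod_XsubC size_iota subn0.
have lead_p : p`_m.+1 = 1.
  by rewrite -[m.+1]/(m.+2.-1) -size_p; apply/monicP/monic_prod_XsubC.
have size_dp : size p^`() = m.+1.
  apply/eqP; rewrite eqn_leq; apply/andP; split.
    by rewrite -ltnS -size_p lt_size_deriv // -size_poly_gt0 size_p.
  rewrite ltnNge; apply/negP => /leq_sizeP/(_ m (leqnn m)).
  by rewrite coef_deriv lead_p => /eqP; rewrite pnatr_eq0.
have lead_dp : lead_coef p^`() = m.+1%:R.
  by rewrite lead_coefE size_dp /= coef_deriv lead_p.
have ord_inj (k l : 'I_m) : r k = r l -> k = l.
  move=> e; apply/val_inj/eqP; case: (ltngtP k l) => // kl.
    by have := r_incr k l; rewrite kl ltn_ord e ltxx => /(_ isT).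
  by have := r_incr l k; rewrite kl ltn_ord e ltxx => /(_ isT).
rewrite (@all_roots_prod_XsubC _ p^`() [seq r k | k : 'I_m]).
- by rewrite lead_dp /prod_roots big_image.
- by rewrite size_map size_enum_ord.
- apply/allP => x /mapP[k _ ->]; apply/rootP.
  by have [] := rP k (ltn_ord k).
by rewrite uniq_rootsE map_inj_uniq ?enum_uniq.
Qed.

(* The number of roots [b j] above [c k] decreases with [k], strictly since its
   parity changes, and it takes [m] values in [0, m-1]. *)
Lemma alternating_signs_interlace m b c :
  increasing_upto m b -> increasing_upto m c ->
  (forall k, (k < m)%N -> 0 < (-1) ^+ (m.-1 - k) * (prod_roots m b).[c k]) ->
  forall k, (k < m)%N -> b k < c k /\ ((k.+1 < m)%N -> c k < b k.+1).
Proof.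
move=> b_incr c_incr sgn.
pose N k := (\sum_(j < m) (c k < b j)%R)%N.
have nz k : (k < m)%N -> (prod_roots m b).[c k] != 0.
  by move/sgn; apply: contraTneq => ->; rewrite mulr0 ltxx.
have parity k : (k < m)%N -> odd (N k) = odd (m.-1 - k).
  move=> km; have := sign_prod_roots (nz k km); have := sgn k km.
  rewrite -/(N k) -signr_odd -[(-1) ^+ N k]signr_odd.
  by case: (odd _); case: (odd _); rewrite ?expr0 ?expr1 //; lra.
have N_step k : (k.+1 < m)%N -> (N k.+1 < N k)%N.
  move=> km; rewrite ltn_neqAle; apply/andP; split.
    apply/negP => /eqP e; have := parity k (ltnW km).
    rewrite -e parity //; have -> : (m.-1 - k = (m.-1 - k.+1).+1)%N by lia.
    by rewrite oddS; case: odd.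
  apply: leq_sum => j _; case: (ltP (c k.+1)) => // lt_cb.
  by rewrite (lt_trans _ lt_cb) // c_incr // ltnSn.
have N_le k : (k < m)%N -> (N k + k <= m.-1)%N.
  elim: k => [|k IH] km; last by have := N_step k km; have := IH (ltnW km); lia.
  have le_m : (N 0 <= m)%N.
    rewrite -[leqRHS]card_ord -sum1_card; apply: leq_sum => j _.
    exact: leq_b1.
  rewrite addn0; move: le_m; rewrite leq_eqVlt => /predU1P[N0|N_lt]; last first.
    by rewrite -ltnS prednK // (leq_ltn_trans _ N_lt).
  (* [N 0 = m] is impossible because [N 0] has the parity of [m.-1]. *)
  have := parity 0%N km; rewrite subn0 N0; case: (m) km => // m' _ /=.
  by case: odd.
(* Counted back from the last index, the strict decrease gives the matching lower bound. *)
have N_ge l : (l <= m.-1)%N -> (l <= N (m.-1 - l))%N.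
  elim: l => [|l IH] // lm.
  rewrite (leq_ltn_trans (IH (ltnW lm))) //.
  have -> : (m.-1 - l = (m.-1 - l.+1).+1)%N by lia.
  by apply: N_step; lia.
have N_eq k : (k < m)%N -> N k = (m.-1 - k)%N.
  move=> km; have := N_ge (m.-1 - k)%N (leq_subr _ _).
  have le_k : (k <= m.-1)%N by lia.
  rewrite subKn // => ge; apply/eqP; rewrite eqn_leq ge andbT.
  by rewrite leq_subRL // addnC N_le.
have b_neq k j : (k < m)%N -> (j < m)%N -> b j != c k.
  move=> km jm; apply: contraNneq (nz k km) => e.
  by rewrite horner_prod_roots_eq0; apply/existsP; exists (Ordinal jm); rewrite /= e.
have N_lo k i : (k < m)%N -> (i < m)%N -> c k < b i -> (m - i <= N k)%N.
  move=> km im lt_cb.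
  rewrite /N -(big_mkord xpredT (fun j => nat_of_bool (c k < b j)%R)).
  rewrite (big_cat_nat (n := i)) //=; last exact: ltnW.
  apply: leq_trans (leq_addl _ _); rewrite -[leqLHS]muln1 -sum_nat_const_nat.
  rewrite big_nat_cond [leqRHS]big_nat_cond; apply: leq_sum => j /andP[/andP[ij jm] _].
  rewrite (lt_le_trans lt_cb) //; move: ij; rewrite leq_eqVlt.
  by case/predU1P=> [->//|ij]; apply/ltW/b_incr; rewrite ij.
have N_hi k i : (k < m)%N -> (i < m)%N -> b i < c k -> (N k <= m - i.+1)%N.
  move=> km im lt_bc.
  rewrite /N -(big_mkord xpredT (fun j => nat_of_bool (c k < b j)%R)).
  rewrite (big_cat_nat (n := i.+1)) //= big_nat_cond big1 ?add0n; last first.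
    move=> j /andP[/andP[_ ji] _]; apply/eqP; rewrite eqb0 -leNgt.
    apply: le_trans (ltW lt_bc); move: ji; rewrite ltnS leq_eqVlt.
    by case/predU1P=> [->//|ij]; apply/ltW/b_incr; rewrite ij.
  rewrite -[leqRHS]muln1 -sum_nat_const_nat; apply: leq_sum => j _.
  exact: leq_b1.
move=> k km; split=> [|k1m].
  rewrite lt_neqAle b_neq //= leNgt; apply/negP => /(N_lo k k km km).
  by rewrite N_eq //; lia.
rewrite lt_neqAle eq_sym b_neq //= leNgt; apply/negP => /(N_hi k k.+1 km k1m).
by rewrite N_eq //; lia.
Qed.

Definition omit i (s : nat -> R) (k : nat) := s (bump i k).

Lemma omit_increasing m i s : increasing_upto m.+1 s -> increasing_upto m (omit i s).
Proof.
move=> s_incr k l /andP[kl lm]; apply: s_incr; rewrite /bump.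
by case: leqP; case: leqP; lia.
Qed.

Lemma prod_roots_omit m i s : (i < m.+1)%N ->
  prod_roots m (omit i s) = \prod_(j < m.+1 | j != i :> nat) ('X - (s j)%:P).
Proof.
move=> im; pose I := Ordinal im.
rewrite (reindex_omap (lift I) (unlift I)) /=; last first.
  by move=> j; case: unliftP => [k ->|->] //=; rewrite eqxx.
apply: eq_big => [k|k _] //; rewrite liftK eqxx andbT.
by have := neq_lift I k; rewrite -val_eqE /= eq_sym => ->.
Qed.

Lemma horner_omit_eq0 m i j s : (i < m.+1)%N -> (j < m.+1)%N -> i != j ->
  (prod_roots m (omit i s)).[s j] = 0.
Proof.
move=> im jm ij; rewrite prod_roots_omit // (bigD1 (Ordinal jm)) 1?eq_sym //=.
by rewrite hornerM hornerXsubC subrr mul0r.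
Qed.

Lemma horner_omit_neq0 m i s : increasing_upto m.+1 s -> (i < m.+1)%N ->
  (prod_roots m (omit i s)).[s i] != 0.
Proof.
move=> s_incr im; rewrite prod_roots_omit // horner_prod.
apply/prodf_neq0 => j ij; rewrite hornerXsubC subr_eq0.
case: (ltngtP i j) ij => // ij _; first by rewrite lt_eqF // s_incr // ij /=.
by rewrite gt_eqF // s_incr // ij.
Qed.

Lemma poly_increasing_roots_eq0 m t p : increasing_upto m t -> (size p <= m)%N ->
  (forall k, (k < m)%N -> p.[t k] = 0) -> p = 0.
Proof.
move=> t_incr size_p pt; apply: contraTeq size_p => p0; rewrite -ltnNge.
have := @max_poly_roots _ p (map t (iota 0 m)) p0.
rewrite size_map size_iota; apply.
  by apply/allP => x /mapP[k]; rewrite mem_iota => /andP[_ km] ->; apply/rootP/pt.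
rewrite map_inj_in_uniq ?iota_uniq // => k l; rewrite !mem_iota !add0n.
move=> /andP[_ km] /andP[_ lm] e; case: (ltngtP k l) => // kl.
  by have := t_incr k l; rewrite kl lm e ltxx => /(_ isT).
by have := t_incr l k; rewrite kl km e ltxx => /(_ isT).
Qed.

Lemma size_prod_roots m t : size (prod_roots m t) = m.+1.
Proof.
rewrite /prod_roots -(big_mkord xpredT (fun k => 'X - (t k)%:P)).
by rewrite size_prod_XsubC size_iota subn0.
Qed.

Lemma lagrange_interpolation m s p : increasing_upto m.+1 s -> (size p <= m.+1)%N ->
  p = \sum_(i < m.+1) (p.[s i] / (prod_roots m (omit i s)).[s i]) *:
                      prod_roots m (omit i s).
Proof.
move=> s_incr size_p; apply/eqP; rewrite -subr_eq0; apply/eqP.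
apply: (poly_increasing_roots_eq0 s_incr) => [|k km].
  rewrite (leq_trans (size_polyD _ _)) // geq_max size_p size_polyN.
  apply: (leq_trans (size_sum _ _ _)); apply/bigmax_leqP => i _.
  by rewrite (leq_trans (size_scale_leq _ _)) // size_prod_roots.
rewrite hornerD hornerN horner_sum (bigD1 (Ordinal km)) //= hornerZ.
rewrite divfK ?horner_omit_neq0 // big1 ?addr0 ?subrr // => i ik.
rewrite hornerZ (@horner_omit_eq0 m i k) ?mulr0 ?ltn_ord //.
Qed.

(** * V. A. Markov's theorem on interlacing critical points *)

Section Markov.
Variables (m : nat) (s : nat -> R) (r : nat -> nat -> R).
Let P i := prod_roots m.+1 (omit i s).
Hypothesis s_incr : increasing_upto m.+2 s.
Hypothesis rP : forall i k, (k < m)%N ->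
  omit i s k < r i k < omit i s k.+1 /\ (P i)^`().[r i k] = 0.

Let dP i : increasing_upto m (r i) /\ (P i)^`() = m.+1%:R *: prod_roots m (r i).
Proof. by apply: deriv_prod_roots_factor; [exact: omit_increasing|exact: rP]. Qed.

Let pnat : 0 < m.+1%:R :> R. Proof. by rewrite ltr0n. Qed.

(* With [P i = (X - s j) q] and [P j = (X - s i) q], the Wronskian identity
   [P i * (P j)' - (P i)' * P j = (s i - s j) q^2] shows that [(P j)'] has the sign
   opposite to [P i] at the zeros of [(P i)']. *)
Lemma critical_points_interlace i j k : (i < j < m.+2)%N -> (k < m)%N ->
  r j k < r i k /\ ((k.+1 < m)%N -> r i k < r j k.+1).
Proof.
move=> /andP[ij jm] km; have im := ltn_trans ij jm.
move: k km; apply: alternating_signs_interlace; [exact: (dP j).1|exact: (dP i).1|].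
move=> k km; have [/andP[lo hi] crit] := rP i km.
(* Exactly the first [k+1] of the [m+1] roots of [P i] lie below [r i k]. *)
have sgnP : 0 < (-1) ^+ (m - k) * (P i).[r i k].
  apply: (@sign_prod_roots_between m.+1 _ _ k.+1) => [|l lk|l /andP[kl lm]].
  - exact: ltnW.
  - apply: le_lt_trans lo; move: lk; rewrite ltnS leq_eqVlt => /predU1P[->//|lk].
    by apply/ltW/(omit_increasing i s_incr); rewrite lk ltnS ltnW.
  - apply: (lt_le_trans hi); move: kl; rewrite leq_eqVlt => /predU1P[->//|kl].
    by apply/ltW/(omit_increasing i s_incr); rewrite kl.
pose q := \prod_(l < m.+2 | (l != i :> nat) && (l != j :> nat)) ('X - (s l)%:P).
have Pi : P i = ('X - (s j)%:P) * q.
  by rewrite /P prod_roots_omit // (bigD1 (Ordinal jm)) // eq_sym (ltn_eqF ij).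
have Pj : P j = ('X - (s i)%:P) * q.
  rewrite /P prod_roots_omit // (bigD1 (Ordinal im)) /= ?(ltn_eqF ij) //.
  by congr (_ * _); apply: eq_bigl => l; rewrite andbC.
have sij : s i < s j by rewrite s_incr // ij.
have := (dP j).2; rewrite -/(P j) => dPj.
have {}dPj : (P j)^`().[r i k] = m.+1%:R * (prod_roots m (r j)).[r i k].
  by rewrite dPj hornerZ.
move: crit dPj sgnP; rewrite Pi Pj !derivM !derivXsubC !hornerE.
set x := r i k; set y := q.[x]; set dy := q^`().[x]; set e := _.[x].
have -> : (m - k = (m.-1 - k).+1)%N by lia.
rewrite exprS; set f := _ ^+ _ => crit dPe sgn.
(* At [x] the equation [crit] reads [q = -(x - s j) q'], so [P i] takes the value [-(x - s j)^2 q']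
   there. *)
have {}sgn : 0 < (x - s j) ^+ 2 * (f * dy).
  have -> : (x - s j) ^+ 2 * (f * dy) = (-1 * f) * (x - s j) * y.
    by rewrite (_ : y = - ((x - s j) * dy)); [ring|lra].
  exact: sgn.
have fdy : 0 < f * dy.
  by rewrite ltNge; apply: contraTN sgn => ?; rewrite -leNgt mulr_ge0_le0 ?sqr_ge0.
rewrite -(pmulr_rgt0 _ pnat) mulrCA -dPe.
(* The same substitution turns the value of [(P j)'] at [x] into [(s j - s i) q']. *)
have -> : f * (y + (x - s i) * dy) = (s j - s i) * (f * dy).
  by rewrite (_ : y = - ((x - s j) * dy)); [ring|lra].
by rewrite mulr_gt0 // subr_gt0.
Qed.

(** By interlacing, [r i k] decreases in [i], so the interval from [r 1 k.-1] to [r m.+1 k] consists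
    of the points lying between the same two consecutive critical points of every [P i], where all
    derivatives have the sign of [(-1)^(m-k)]; for [k = 0] or [k = m] an end is infinite. Between
    [r m.+1 k] and [r 1 k] the derivatives of [P 1] and [P m.+1] have opposite signs. The index 0 is
    left out because [s 0] will be the root 0 common to all the Lagrange polynomials. *)
Lemma same_sign_region z :
  (exists k, [/\ (k <= m)%N, (0 < k)%N -> r 1 k.-1 < z & (k < m)%N -> z < r m.+1 k])
  <-> exists tau, forall i, (1 <= i <= m.+1)%N -> 0 < tau * (P i)^`().[z].
Proof.
have r_lt1 i k : (1 <= i <= m.+1)%N -> (k < m)%N -> r i k <= r 1 k.
  case/andP; rewrite leq_eqVlt => /predU1P[<-//|i1] im km.
  by apply/ltW; apply: (critical_points_interlace _ km).1; rewrite i1 ltnS.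
have r_gtn i k : (1 <= i <= m.+1)%N -> (k < m)%N -> r m.+1 k <= r i k.
  case/andP=> _; rewrite leq_eqVlt => /predU1P[->//|im] km.
  by apply/ltW; apply: (critical_points_interlace _ km).1; rewrite im ltnSn.
have r_le i k l : (k <= l < m)%N -> r i k <= r i l.
  case/andP; rewrite leq_eqVlt => /predU1P[->//|kl] lm.
  by apply/ltW/(dP i).1; rewrite kl.
have sgn i k : (k <= m)%N -> ((0 < k)%N -> r i k.-1 < z) ->
    ((k < m)%N -> z < r i k) -> 0 < (-1) ^+ (m - k) * (P i)^`().[z].
  move=> km lo hi; rewrite (dP i).2 hornerZ mulrCA mulr_gt0 //.
  apply: sign_prod_roots_between => // l => [lk|/andP[kl lm]].
    apply: le_lt_trans (lo _); last exact: leq_ltn_trans lk.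
    by apply: r_le; lia.
  by apply: (lt_le_trans (hi _)); [exact: leq_ltn_trans lm|apply: r_le; rewrite kl].
split=> [[k [km lo hi]]|[tau tauP]].
  exists ((-1) ^+ (m - k)) => i im; apply: sgn => // [k0|lt_km].
    by apply: (le_lt_trans _ (lo k0)); apply: r_lt1 => //; lia.
  by apply: (lt_le_trans (hi lt_km)); apply: r_gtn.
(* The least such [k] is the number of critical points of [P 1] below [z]. *)
have exk : exists k, (k == m) || (z <= r 1 k) by exists m; rewrite eqxx.
case: (ex_minnP exk) => k lek kmin; have km : (k <= m)%N by rewrite kmin ?eqxx.
have nz i l : (1 <= i <= m.+1)%N -> (l < m)%N -> z != r i l.
  move=> im lm; apply: contraTneq (tauP i im) => ->.
  by rewrite (rP i lm).2 mulr0 ltxx.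
have lo : (0 < k)%N -> r 1 k.-1 < z.
  move=> k0; rewrite ltNge; apply/negP => le_z.
  by have := kmin k.-1; rewrite le_z orbT => /(_ isT); rewrite leqNgt prednK ?leqnn.
have hi : (k < m)%N -> z < r 1 k.
  move=> lt_km; rewrite lt_neqAle nz //.
  by move: lek; rewrite (ltn_eqF lt_km).
(* If [z] were beyond [r m.+1 k], it would have passed [k+1] critical points of [P m.+1] but only
   [k] of [P 1], and the two derivatives would differ in sign. *)
exists k; split=> // lt_km; rewrite lt_neqAle nz ?leqnn //= leNgt; apply/negP => lt_z.
have m1 : (1 < m.+1)%N by rewrite ltnS (leq_ltn_trans _ lt_km).
have sgn1 : 0 < (-1) ^+ (m - k) * (P 1)^`().[z] by apply: sgn.
have sgnm : 0 < (-1) ^+ (m - k.+1) * (P m.+1)^`().[z].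
  apply: sgn => // lt_k1m; apply: lt_trans (hi lt_km) _.
  by apply: (critical_points_interlace _ lt_km).2; rewrite // m1 ltnSn.
have e : (m - k = (m - k.+1).+1)%N by rewrite subnSK.
have := tauP 1%N isT; have := tauP m.+1; rewrite leqnn => /(_ isT).
move: sgn1 sgnm; rewrite e exprS mulN1r.
by rewrite -signr_odd; case: odd; rewrite ?expr0 ?expr1; nra.
Qed.

End Markov.
End Interlacing.

(** * Designs as linear functionals on polynomials *)
Section DesignsAsFunctionals.
Variable R : realType.
Implicit Types (p h : {poly R}) (xi eta : {fsfun R -> R with 0}).

Definition intercept_free n p := (size p <= n.+1)%N /\ p.[0] = 0.

Definition poly_of n (v : 'cV[R]_n) : {poly R} := \sum_(i < n) v i 0 *: 'X^(i.+1).

Lemma poly_of_regression n (v : 'cV[R]_n) x :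
  (v^T *m regression_vector n x) 0 0 = (poly_of v).[x].
Proof.
rewrite mxE horner_sum; apply: eq_bigr => i _.
by rewrite !mxE hornerZ hornerXn.
Qed.

Lemma poly_of_slope n (v : 'cV[R]_n) z :
  (v^T *m slope_vector n z) 0 0 = (poly_of v)^`().[z].
Proof.
rewrite mxE raddf_sum horner_sum; apply: eq_bigr => i _.
by rewrite !mxE /= derivZ derivXn hornerZ hornerMn hornerXn mulr_natl.
Qed.

Lemma poly_of_rank1 n (u v : 'cV[R]_n) x :
  (u^T *m (regression_vector n x *m (regression_vector n x)^T) *m v) 0 0 =
  (poly_of u).[x] * (poly_of v).[x].
Proof.
rewrite -!poly_of_regression mulmxA -[_ *m _ *m _ *m v]mulmxA.
rewrite [LHS]mxE big_ord1; congr (_ * _).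
by rewrite -[v in LHS]trmxK -trmx_mul mxE.
Qed.

Lemma poly_of_free n (v : 'cV[R]_n) : intercept_free n (poly_of v).
Proof.
split.
  apply: (leq_trans (size_sum _ _ _)); apply/bigmax_leqP => i _.
  by rewrite (leq_trans (size_scale_leq _ _)) // size_polyXn ltnS.
rewrite horner_sum big1 // => i _.
by rewrite hornerZ hornerXn expr0n mulr0.
Qed.

Lemma intercept_freeE n p : intercept_free n p ->
  p = poly_of (\col_(i < n) p`_i.+1).
Proof.
move=> [size_p p0]; apply/polyP => k; rewrite coef_sum.
under eq_bigr do rewrite coefZ coefXn mxE.
case: k => [|k]; first by rewrite big1 -?horner_coef0 // => i _; rewrite mulr0.
case: (ltnP k n) => kn.
  rewrite (bigD1 (Ordinal kn)) //= eqxx mulr1 big1 ?addr0 // => i ik.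
  by rewrite eqSS -[k]/(val (Ordinal kn)) val_eqE eq_sym (negPf ik) mulr0.
rewrite nth_default ?(leq_trans size_p) // big1 // => i _.
by rewrite eqSS gtn_eqF ?mulr0 // (leq_trans (ltn_ord i)).
Qed.

Lemma intercept_free_lincomb n (b : R) p q :
  intercept_free n p -> intercept_free n q -> intercept_free n (p - b *: q).
Proof.
move=> [size_p p0] [size_q q0]; split; last by rewrite !hornerE p0 q0 mulr0 subrr.
rewrite (leq_trans (size_polyD _ _)) // geq_max size_p size_polyN.
by rewrite (leq_trans (size_scale_leq _ _)).
Qed.

(** If [c = M v], the polynomial [h] of [v] represents the slope functional, since [u^T c = u^T M v]
    is the integral of the product of the polynomials of [u] and [v]. Moreover
    [c^T M^- c = v^T M v = v^T c], which is the slope of [h]. *)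
Lemma finite_criterionP n z xi : (c_criterion (slope_vector n z) xi < +oo)%E ->
  exists h, [/\ intercept_free n h,
    forall p, intercept_free n p ->
      p^`().[z] = \sum_(x <- finsupp xi) xi x * (p.[x] * h.[x])
    & c_criterion (slope_vector n z) xi = (h^`().[z])%:E].
Proof.
rewrite /c_criterion; case: asboolP => [[v cE] _|_]; last by rewrite ltxx.
exists (poly_of v); split=> [|p pn|]; first exact: poly_of_free.
  rewrite (intercept_freeE pn) -poly_of_slope cE mulmxA mulmx_sumr mulmx_suml summxE.
  apply: eq_bigr => x _; rewrite -scalemxAr -scalemxAl mxE.
  by rewrite poly_of_rank1.
congr _%:E; rewrite -poly_of_slope.
have sM := information_matrix_sym n xi.
move: (pinvmx_ginv (information_matrix n xi)); move: (pinvmx _) => G GE.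
by rewrite cE trmx_mul sM !mulmxA -[_ *m _ *m G]mulmxA -[_ *m (_ *m G) *m _]mulmxA GE.
Qed.

(** The points may coincide and the weights may vanish; weights at equal points are added. [F] takes
    values in a module so that the formula covers both information matrices and scalar integrals. *)
Lemma fsfun_of_family (I : finType) (pt w : I -> R) : (forall i, 0 <= w i) ->
  exists xi, (forall (V : lmodType R) (F : R -> V),
      \sum_(x <- finsupp xi) xi x *: F x = \sum_i w i *: F (pt i)) /\
    (forall x, x \in finsupp xi -> 0 < xi x /\ exists i, x = pt i).
Proof.
move=> w0; pose X := [fset pt i | i in I]%fset.
pose wt x := \sum_i w i *+ (pt i == x).
pose xi : {fsfun R -> R with 0} := [fsfun x in X => wt x]%fset; exists xi.
have ptX i : pt i \in X by apply/imfsetP; exists i.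
have wt_ge0 x : 0 <= wt x by apply: sumr_ge0 => i _; rewrite mulrn_wge0.
have xiX x : x \in finsupp xi -> x \in X.
  by rewrite finsupp_fsfun !inE => /andP[].
have xiE x : xi x = wt x.
  rewrite fsfunE; case: ifPn => // xX; rewrite /wt big1 // => i _.
  by case: eqP => // e; rewrite -e ptX in xX.
split=> [V F|x xx]; last first.
  split; last by have /imfsetP[i _ ->] := xiX x xx; exists i.
  by rewrite lt_neqAle xiE wt_ge0 eq_sym -xiE andbT -mem_finsupp.
rewrite (big_fset_incl _ (B := X)) /=; last first.
- by move=> x _; rewrite memNfinsupp => /eqP ->; rewrite scale0r.
- by apply/fsubsetP => x; apply: xiX.
under eq_bigr do rewrite xiE scaler_suml.
rewrite exchange_big /=; apply: eq_bigr => i _.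
rewrite (bigD1_seq (pt i)) ?fset_uniq ?ptX //= eqxx mulr1n big1 ?addr0 // => x.
by rewrite eq_sym => /negPf ->; rewrite mulr0n scale0r.
Qed.

(** Any representation of the slope functional bounds the criterion, even when [g] does not come
    from a polynomial: the representing [h] is the orthogonal projection of [g] on the
    intercept-free polynomials, and the two sides differ by the integral of [(g - h)^2]. *)
Lemma weighted_design n a z (I : finType) (pt w g : I -> R) :
  (forall i, 0 <= pt i <= a) -> (forall i, 0 <= w i) -> \sum_i w i = 1 ->
  (forall p, intercept_free n p ->
     p^`().[z] = \sum_i w i * (p.[pt i] * g i)) ->
  exists xi, is_design a xi /\
    (c_criterion (slope_vector n z) xi <= (\sum_i w i * g i ^+ 2)%:E)%E.
Proof.
move=> pt_in w0 w1 rep; have [xi [sum_xi supp_xi]] := fsfun_of_family pt w0.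
have sum_xi1 (F : R -> R) : \sum_(x <- finsupp xi) xi x * F x = \sum_i w i * F (pt i).
  exact: (sum_xi R^o F).
exists xi; split.
  split=> [x /supp_xi[x0 [i xE]]|]; first by split=> //; rewrite xE pt_in.
  rewrite -w1; transitivity (\sum_i w i * 1); last by apply: eq_bigr => i _; rewrite mulr1.
  by rewrite -(sum_xi1 (fun=> 1)); apply: eq_bigr => x _; rewrite mulr1.
have quad u v : (u^T *m information_matrix n xi *m v) 0 0 =
    \sum_i w i * ((poly_of u).[pt i] * (poly_of v).[pt i]).
  rewrite /information_matrix sum_xi mulmx_sumr mulmx_suml summxE.
  apply: eq_bigr => i _; rewrite -scalemxAr -scalemxAl mxE.
  by rewrite poly_of_rank1.
have sM := information_matrix_sym n xi; set M := information_matrix n xi in quad sM *.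
(* The range of the symmetric [M] is orthogonal to its kernel. A kernel vector [u] gives a
   polynomial vanishing wherever the weight is positive, so by [rep] its slope at [z] is 0. *)
have range : exists v, slope_vector n z = M *m v.
  suff /submxP[D cD] : ((slope_vector n z)^T <= M)%MS.
    by exists D^T; rewrite -[LHS]trmxK cD trmx_mul sM.
  rewrite submxE; apply/eqP/matrixP => i j; rewrite [RHS]mxE ord1 {i}.
  pose u := col j (cokermx M).
  have Mu0 : M *m u = 0 by rewrite /u colE mulmxA mulmx_coker mul0mx.
  have pu0 i : w i * (poly_of u).[pt i] = 0.
    have := quad u u; rewrite -mulmxA Mu0 mulmx0 mxE => /esym/eqP.
    rewrite psumr_eq0 => [/allP/(_ i (mem_index_enum i))|k _]; last first.
      by rewrite mulr_ge0 // -expr2 sqr_ge0.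
    by rewrite /= !mulf_eq0 orbb => /orP[] /eqP ->; rewrite ?mul0r ?mulr0.
  transitivity ((u^T *m slope_vector n z) 0 0).
    by rewrite /u !mxE; apply: eq_bigr => k _; rewrite !mxE mulrC.
  rewrite poly_of_slope rep; last exact: poly_of_free.
  by apply: big1 => i _; rewrite mulrA pu0 mul0r.
have fin : (c_criterion (slope_vector n z) xi < +oo)%E.
  by rewrite /c_criterion asboolT ?ltry.
have [h [h_free hE ->]] := finite_criterionP fin; rewrite lee_fin.
have hh := hE h h_free; rewrite (sum_xi1 (fun x => h.[x] * h.[x])) in hh.
have hg := rep h h_free; rewrite -subr_ge0.
have -> : \sum_i w i * g i ^+ 2 - h^`().[z] = \sum_i w i * (g i - h.[pt i]) ^+ 2.
  transitivity (\sum_i w i * g i ^+ 2 - 2 * \sum_i w i * (h.[pt i] * g i) +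
                \sum_i w i * (h.[pt i] * h.[pt i])); first by rewrite -hg -hh; ring.
  rewrite mulr_sumr -sumrB -big_split; apply: eq_bigr => i _ /=; ring.
by apply: sumr_ge0 => i _; rewrite mulr_ge0 ?sqr_ge0.
Qed.

End DesignsAsFunctionals.

(** * Chebyshev polynomials and equioscillation *)
Section Equioscillation.
Variables (R : realType) (n : nat) (a : R).
Hypotheses (n0 : (0 < n)%N) (a0 : 0 < a).
Implicit Types (p h : {poly R}).

Lemma cos_natmul_pi k : cos (k%:R * pi) = (-1) ^+ k :> R.
Proof.
elim: k => [|k IH]; first by rewrite mul0r cos0.
by rewrite -natr1 mulrDl mul1r cosDpi IH exprS mulN1r.
Qed.

Lemma sin_natmul_pi k : sin (k%:R * pi) = 0 :> R.
Proof.
elim: k => [|k IH]; first by rewrite mul0r sin0.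
by rewrite -natr1 mulrDl mul1r sinDpi IH oppr0.
Qed.

Lemma chebyshev_exists k : exists T : {poly R},
  (size T <= k.+1)%N /\ forall t, T.[cos t] = cos (k%:R * t).
Proof.
(* The recurrence [T_(k+2) = 2 X T_(k+1) - T_k] requires carrying two consecutive polynomials. *)
suff [T [_ [sT _ TE _]]] : exists T U : {poly R},
    [/\ (size T <= k.+1)%N, (size U <= k.+2)%N,
        forall t, T.[cos t] = cos (k%:R * t)
      & forall t, U.[cos t] = cos (k.+1%:R * t)] by exists T.
elim: k => [|k [T [U [sT sU TE UE]]]].
  exists 1, 'X; split=> [|||t]; rewrite ?size_poly1 ?size_polyX //.
    by move=> t; rewrite hornerC mul0r cos0.
  by rewrite hornerX mul1r.
exists U, (2 *: ('X * U) - T); split=> // [|t].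
  rewrite (leq_trans (size_polyD _ _)) // geq_max size_polyN.
  rewrite (leq_trans sT) ?andbT; last by rewrite !ltnS leqW.
  rewrite (leq_trans (size_scale_leq _ _)) // (leq_trans (size_polyMleq _ _)) //.
  by rewrite size_polyX.
rewrite hornerD hornerN hornerZ hornerM hornerX TE UE.
have -> : k.+2%:R * t = k.+1%:R * t + t by rewrite -natr1; ring.
have -> : k%:R * t = k.+1%:R * t - t by rewrite -natr1; ring.
rewrite !cosD cosN sinN; ring.
Qed.

Let c : R := cos (pi / (2 * n%:R)).

Let nR : 0 < n%:R :> R. Proof. by rewrite ltr0n. Qed.

Let c_ge0 : 0 <= c.
Proof.
apply: cos_ge0_pihalf; have p0 : 0 < pi :> R := pi_gt0 R.
have h : 0 <= @pi R / (2 * n%:R) <= pi / 2.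
  rewrite divr_ge0 ?mulr_ge0 ?(ltW p0) //=.
  rewrite ler_pM2l // lef_pV2 ?posrE ?mulr_gt0 //.
  by rewrite ler_peMr // ler1n.
move: h => /andP[h ->]; rewrite andbT; apply: le_trans h.
by rewrite oppr_cp0; apply: divr_ge0 => //; exact: ltW.
Qed.

Let c1_gt0 : 0 < 1 + c. Proof. by rewrite ltr_wpDr. Qed.

Lemma node_last : node n a n = a.
Proof. by rewrite /node subnn !mul0r cos0 -/c divff ?mulr1 ?gt_eqF. Qed.

Lemma node_gt0 i : (0 < i <= n)%N -> 0 < node n a i.
Proof.
move=> /andP[i0 ilen]; rewrite /node -/c mulr_gt0 // divr_gt0 //.
have p0 : 0 < pi :> R := pi_gt0 R.
(* [-c] is the cosine of [(n - 1/2) pi / n], and [(n - i) pi / n] is a smaller angle as [i >= 1]. *)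
have -> : c = - cos (pi - pi / (2 * n%:R)).
  by rewrite addrC cosDpi cosN opprK.
have e : pi - pi / (2 * n%:R) = (n%:R - 2^-1) * pi / n%:R :> R.
  by field; rewrite gt_eqF.
have in_pi (x : R) : 0 <= x <= n%:R -> x * pi / n%:R \in `[0, @pi R].
  case/andP=> x0 xn; rewrite in_itv /= divr_ge0 ?mulr_ge0 ?(ltW p0) ?ler0n //=.
  by rewrite ler_pdivrMr // mulrC ler_pM2l.
have n1 : 1 <= n%:R :> R by rewrite ler1n.
rewrite subr_gt0 e ltr_cos ?in_pi //.
- rewrite ltr_pM2r ?invr_gt0 // ltr_pM2r // natrB //.
  have : 1 <= i%:R :> R by rewrite ler1n.
  lra.
- by rewrite ler0n ler_nat leq_subr.
- by apply/andP; split; lra.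
Qed.

Lemma node_in i : (0 < i <= n)%N -> 0 <= node n a i <= a.
Proof.
move=> /[dup] /node_gt0/ltW -> /andP[i0]; rewrite leq_eqVlt => /predU1P[->|ltn].
  by rewrite node_last lexx.
by rewrite -[leRHS]node_last ltW // node_increasing // ltn /=.
Qed.

(** The affine map [l] sends [[0, a]] onto [[-c, 1]], the node [i] to the extremal point
    [cos ((n-i) pi / n)] of the Chebyshev polynomial, and 0 to [-c = cos (pi + pi / (2n))], one of
    its zeros; hence the composite has no intercept. *)
Lemma shifted_chebyshev_exists : exists S : {poly R},
  [/\ intercept_free n S, forall x, 0 <= x <= a -> S.[x] ^+ 2 <= 1
    & forall i, (i <= n)%N -> S.[node n a i] = (-1) ^+ (n - i)].
Proof.
have [T [sT TE]] := chebyshev_exists n.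
pose l := ((1 + c) / a)%:P * 'X - c%:P.
have lE x : l.[x] = (1 + c) / a * x - c by rewrite !hornerE.
exists (T \Po l); split.
- split.
    apply: leq_trans (size_comp_poly_leq _ _) _.
    have : (size l <= 2)%N.
      rewrite (leq_trans (size_polyD _ _)) // geq_max size_polyN.
      rewrite (leq_trans (size_polyC_leq1 _)) // andbT.
      rewrite (leq_trans (size_polyMleq _ _)) // size_polyX.
      by have := size_polyC_leq1 ((1 + c) / a); lia.
    by move=> sl; rewrite ltnS; nia.
  rewrite horner_comp lE mulr0 sub0r -cosDpi TE.
  have -> : n%:R * (pi / (2 * n%:R) + pi) = n%:R * pi + pi / 2 :> R.
    by field; rewrite gt_eqF.
  by rewrite cosDpihalf sin_natmul_pi oppr0.
- move=> x /andP[x0 xa]; rewrite horner_comp lE.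
  set u := _ - c; have cu : - c <= u.
    by rewrite lerBDr addNr mulr_ge0 // divr_ge0 ?ltW.
  have u1 : u <= 1.
    by rewrite lerBlDr mulrAC ler_pdivrMr // ler_pM2l.
  have c1 : c <= 1 by apply: cos_le1.
  rewrite -[u]acosK ?TE; last by rewrite in_itv /= u1 andbT; lra.
  by have := cos_geN1 (n%:R * acos u); have := cos_le1 (n%:R * acos u); nra.
- move=> i ilen; rewrite horner_comp lE /node -/c.
  set k := (n - i)%N; set ck := cos _.
  have -> : (1 + c) / a * (a * ((ck + c) / (1 + c))) - c = ck.
    by field; rewrite !gt_eqF.
  rewrite TE; have -> : n%:R * (k%:R * pi / n%:R) = k%:R * pi :> R.
    by field; rewrite gt_eqF.
  exact: cos_natmul_pi.
Qed.

(** The square of [p] has an interior maximum at [x], so [2 p p'] vanishes there, while [p] does not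
    since [B > 0]. *)
Lemma interior_extremum_deriv p (B x : R) : 0 < B -> 0 < x < a ->
  (forall y, 0 <= y <= a -> p.[y] ^+ 2 <= B) -> p.[x] ^+ 2 = B ->
  p^`().[x] = 0.
Proof.
move=> B0 x_in pB pxB; have px0 : p.[x] != 0.
  by move: B0; rewrite -pxB; apply: contraTneq => ->; rewrite expr0n ltxx.
have := @derive1_at_max R (horner (p * p)) 0 a x (ltW a0).
case=> [t _|//|t|_ /=]; first exact: derivable_horner.
  rewrite in_itv /= => /andP[t0 ta]; rewrite !hornerM -!expr2 pxB.
  by apply: pB; rewrite !ltW.
rewrite -derive1E -derivE derivM !hornerE => /eqP.
by rewrite mulrC -mulr2n mulrn_eq0 /= mulf_eq0 (negPf px0) => /eqP.
Qed.

End Equioscillation.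

(** * Rigidity of polynomials equioscillating at the nodes *)

Section Extremal.
Variables (R : realType) (n : nat) (a : R).
Hypotheses (n0 : (0 < n)%N) (a0 : 0 < a).
Implicit Types (p h : {poly R}).

Lemma deriv_eq0_intercept_free p : p.[0] = 0 -> p^`() = 0 -> p = 0.
Proof.
move=> p0 dp; apply/polyP => -[|k]; first by rewrite -horner_coef0 p0 coef0.
have := coef_deriv p k; rewrite dp !coef0 => /esym/eqP.
by rewrite mulrn_eq0 /= => /eqP.
Qed.

Lemma node_shift_increasing : increasing_upto n (fun k => node n a k.+1).
Proof. by move=> i j /andP[ij jn]; rewrite node_increasing // ltnS ij. Qed.

(** The size of [p'] is at most [n-1], the number of interior nodes at which it vanishes. *)
Lemma critical_nodes_eq0 p : intercept_free n.-1 p ->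
  (forall i, (0 < i < n)%N -> p^`().[node n a i] = 0) -> p = 0.
Proof.
move=> [sp p0] dp; apply: deriv_eq0_intercept_free => //.
apply: (@poly_increasing_roots_eq0 _ n.-1 (fun k => node n a k.+1)).
- move=> i j ij; apply: node_shift_increasing; lia.
- have [->|pn0] := eqVneq p 0; first by rewrite derivC size_poly0.
  by rewrite -ltnS (leq_trans (lt_size_deriv pn0)).
- by move=> k kn; apply: dp; lia.
Qed.

(** Only the squares are prescribed; for [B > 0] the alternation of the signs follows from
    proportionality to the shifted Chebyshev polynomial. *)
Definition equioscillating (B : R) p :=
  [/\ intercept_free n p, forall x, 0 <= x <= a -> p.[x] ^+ 2 <= B
    & forall i, (0 < i <= n)%N -> p.[node n a i] ^+ 2 = B].

Lemma equioscillating_critical B p : 0 < B -> equioscillating B p ->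
  forall i, (0 < i < n)%N -> p^`().[node n a i] = 0.
Proof.
move=> B0 [_ pB pn] i /andP[i0 ltn]; have i_in : (0 < i <= n)%N by rewrite i0 ltnW.
apply: (interior_extremum_deriv a0 B0 _ pB (pn i i_in)).
by rewrite node_gt0 //= -[X in _ < X](node_last a n0) node_increasing // ltn /=.
Qed.

(** A further extremal point would be interior, since [p] vanishes at 0 and [a] is a node, so [p']
    would have [n] zeros with degree at most [n-1]. *)
Lemma equioscillating_extremal B p x : 0 < B -> equioscillating B p ->
  0 <= x <= a -> p.[x] ^+ 2 = B -> exists2 i, (0 < i <= n)%N & x = node n a i.
Proof.
move=> B0 pE; have [[sp p0] pB pn] := pE => /andP[x0 xa] px.
have [//|x_nodes] := pselect (exists2 i, (0 < i <= n)%N & x = node n a i).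
have x_neq0 : x != 0.
  by apply: contraTneq B0 => x_0; rewrite -px x_0 p0 expr0n ltxx.
have x_neqa : x != a.
  apply/eqP => xaE; apply: x_nodes; exists n; first by rewrite n0 leqnn.
  by rewrite node_last.
have dpx : p^`().[x] = 0.
  apply: (interior_extremum_deriv a0 B0 _ pB px).
  by rewrite lt_neqAle eq_sym x_neq0 x0 lt_neqAle x_neqa.
suff dp0 : p^`() = 0.
  by have := B0; rewrite -px (deriv_eq0_intercept_free p0 dp0) hornerC expr0n ltxx.
apply/eqP; apply: contraT => dp_neq0.
have := @max_poly_roots _ p^`() (x :: [seq node n a i | i <- iota 1 n.-1]) dp_neq0.
have node_iota i : i \in iota 1 n.-1 -> (0 < i < n)%N by rewrite mem_iota; lia.
have pn0 : p != 0 by apply: contraNneq dp_neq0 => ->; rewrite derivC.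
have : (size p^`() <= n)%N by rewrite -ltnS (leq_trans (lt_size_deriv pn0)).
move=> sdp; rewrite /= size_map size_iota prednK // ltnNge sdp; apply.
  rewrite rootE dpx eqxx; apply/allP => _ /mapP[i /node_iota i_in ->].
  by apply/rootP; apply: equioscillating_critical B0 pE _ i_in.
rewrite map_inj_in_uniq ?iota_uniq ?andbT.
  apply/mapP => -[i /node_iota/andP[i0 ltn] xE]; apply: x_nodes.
  by exists i => //; rewrite i0 ltnW.
move=> i j /node_iota i_in /node_iota j_in e; case: (ltngtP i j) => // ij.
  suff : node n a i < node n a j by rewrite e ltxx.
  by apply: node_increasing => //; lia.
suff : node n a j < node n a i by rewrite e ltxx.
by apply: node_increasing => //; lia.
Qed.

(** Subtracting the multiple of [q] that cancels the coefficient of degree [n] leaves a polynomial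
    of lower degree still critical at the interior nodes, hence zero. The same argument shows that
    [q] has degree exactly [n]. *)
Lemma equioscillating_proportional B C p q : 0 < B -> 0 < C ->
  equioscillating B p -> equioscillating C q -> exists b, p = b *: q.
Proof.
move=> B0 C0 pE qE; have [pf _ pn] := pE; have [qf _ qn] := qE.
have q_n : q`_n != 0.
  apply/eqP => q_n; have := qn n; rewrite n0 leqnn => /(_ isT).
  rewrite (_ : q = 0); first by rewrite hornerC expr0n => C_0; rewrite -C_0 ltxx in C0.
  apply: critical_nodes_eq0; last exact: equioscillating_critical qE.
  split; last exact: qf.2.
  apply/leq_sizeP => j; rewrite prednK // leq_eqVlt => /predU1P[<-//|nj].
  by move/leq_sizeP: qf.1 => ->.
exists (p`_n / q`_n); apply/eqP; rewrite -subr_eq0; apply/eqP.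
have [sd d0] := intercept_free_lincomb (p`_n / q`_n) pf qf.
apply: critical_nodes_eq0 => [|i i_in].
  split=> //; apply/leq_sizeP => j; rewrite prednK // leq_eqVlt => /predU1P[<-|nj].
    by rewrite coefB coefZ divfK // subrr.
  by move/leq_sizeP: sd => ->.
rewrite derivB derivZ hornerD hornerN hornerZ.
by rewrite (equioscillating_critical B0 pE) // (equioscillating_critical C0 qE) // mulr0 subrr.
Qed.

End Extremal.

(** * Slopes of the Lagrange polynomials *)
Lemma kth_root_increasing (R : realType) (g : R -> R) m (r : nat -> R) :
  increasing_upto m r ->
  (forall x, g x = 0 <-> exists2 k, (k < m)%N & x = r k) ->
  forall k, (k < m)%N -> kth_root g k.+1 = r k.
Proof.
move=> r_incr gE.
have lt_r i j : (i < m)%N -> (j < m)%N -> r i < r j -> (i < j)%N.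
  move=> im jm; apply: contraTltn; rewrite leq_eqVlt -leNgt.
  by case/predU1P=> [->//|ji]; rewrite ltW // r_incr // ji.
(* The zeros below [r k] are the [r j] with [j < k], so the number of smaller zeros singles out
   [r k]; [kth_root] counts from 1 and [r] from 0. *)
have card_below k : (k < m)%N -> ([set y | g y = 0 /\ y < r k] #= `I_k)%card.
  move=> km; have -> : [set y | g y = 0 /\ y < r k] = r @` `I_k.
    apply/seteqP; split=> [y [/gE[j jm ->] /lt_r lt_jk]|_ [j /= jk <-]].
      by exists j => //=; apply: lt_jk.
    split; last by apply: r_incr; rewrite jk.
    by apply/gE; exists j => //; apply: ltn_trans km.
  apply: inj_card_eq => i j; rewrite !inE /= => ik jk e.
  case: (ltngtP i j) => // ij.
    by have := r_incr i j; rewrite ij e ltxx (ltn_trans jk) // => /(_ isT).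
  by have := r_incr j i; rewrite ij e ltxx (ltn_trans ik) // => /(_ isT).
move=> k km; apply: xget_unique => [|y [/gE[l lm ->]] /= card_l].
  by split; [apply/gE; exists k|exact: card_below].
have := card_eq_trans (card_esym (card_below l lm)) card_l.
by move/card_eq_II => ->.
Qed.

Section Slope.
Variables (R : realType) (m : nat) (a : R).
Let n := m.+1.
Hypotheses (m0 : (0 < m)%N) (a0 : 0 < a).
Implicit Types (p h : {poly R}) (xi : {fsfun R -> R with 0}).

(* The root 0 of every [L i] takes index 0; the formula of [node] would give a
   negative [node n a 0]. *)
Let s k := if k is 0 then 0 else node n a k.
Let P i := prod_roots n (omit i s).

Lemma nodes0_increasing : increasing_upto n.+1 s.
Proof.
move=> [|i] [|j] //=; rewrite ?ltnS => jn; first by apply: node_gt0.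
by apply: node_increasing; rewrite ?ltnS.
Qed.
Let s_incr := nodes0_increasing.

(** With 0 added to the nodes, these are ordinary Lagrange polynomials for the [n+1] points
    [s 0, ..., s n], which makes the interlacing results applicable. *)
Lemma lagrange_no_interceptE i : (0 < i <= n)%N ->
  lagrange_no_intercept n a i = (P i).[s i]^-1 *: P i.
Proof.
move=> /andP[i0 ilen].
have PE : P i = 'X * \prod_(1 <= j < n.+1 | j != i) ('X - (node n a j)%:P).
  rewrite /P prod_roots_omit //.
  rewrite -(big_mkord (fun j => j != i) (fun j => 'X - (s j)%:P)).
  rewrite big_ltn_cond // eq_sym -lt0n i0 /= subr0; congr (_ * _).
  by rewrite big_nat_cond [RHS]big_nat_cond; apply: eq_bigr => -[|j].
rewrite /lagrange_no_intercept -PE; congr (_^-1 *: _).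
rewrite PE hornerM hornerX horner_prod; case: (i) i0 => // i' _; congr (_ * _).
by apply: eq_bigr => j _; rewrite hornerXsubC.
Qed.

Lemma sum_nodes (F : nat -> R) : \sum_(1 <= j < n.+1) F j = \sum_(i < n) F i.+1.
Proof. by rewrite big_add1 big_mkord. Qed.

Lemma node_interpolation p : intercept_free n p ->
  p = \sum_(i < n) p.[node n a i.+1] *: lagrange_no_intercept n a i.+1.
Proof.
move=> [sp p0]; rewrite [LHS](lagrange_interpolation s_incr sp).
(* The term of the added node 0 drops out because [p] vanishes there. *)
rewrite big_ord_recl /= p0 mul0r scale0r add0r.
apply: eq_bigr => i _ /=; rewrite lagrange_no_interceptE ?ltn_ord //.
by rewrite scalerA.
Qed.

Lemma value_interpolation x p : intercept_free n p ->
  p.[x] = \sum_(i < n) p.[node n a i.+1] * (lagrange_no_intercept n a i.+1).[x].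
Proof.
move=> pf; rewrite [in LHS](node_interpolation pf) horner_sum.
by apply: eq_bigr => i _; rewrite hornerZ.
Qed.

Lemma slope_interpolation z p : intercept_free n p ->
  p^`().[z] = \sum_(i < n) p.[node n a i.+1] * (lagrange_no_intercept n a i.+1)^`().[z].
Proof.
move=> pf; rewrite [in LHS](node_interpolation pf) raddf_sum horner_sum.
by apply: eq_bigr => i _ /=; rewrite derivZ hornerZ.
Qed.

Lemma lagrange_intercept_free i : (0 < i <= n)%N -> intercept_free n (lagrange_no_intercept n a i).
Proof.
move=> /[dup] i_in /andP[i0 ilen]; rewrite lagrange_no_interceptE //; split.
  by rewrite (leq_trans (size_scale_leq _ _)) // size_prod_roots.
by rewrite hornerZ (@horner_omit_eq0 _ n i 0 s) ?mulr0 // -lt0n.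
Qed.

Lemma lagrange_nodes i j : (0 < i <= n)%N -> (0 < j <= n)%N ->
  (lagrange_no_intercept n a i).[node n a j] = (i == j)%:R.
Proof.
move=> i_in j_in; rewrite lagrange_no_interceptE // hornerZ.
have sj : node n a j = s j by case: (j) j_in.
move: i_in j_in => /andP[i0 ilen] /andP[j0 jn]; rewrite sj.
case: eqVneq => [->|ij]; first by rewrite mulVf ?horner_omit_neq0.
by rewrite (@horner_omit_eq0 _ n i j s) ?mulr0.
Qed.

(** By interpolation this is the largest slope at [z] of an intercept-free polynomial bounded by 1
    in absolute value at the nodes. *)
Definition lebesgue_slope z := \sum_(1 <= j < n.+1) `|(lagrange_no_intercept n a j)^`().[z]|.

(** If every term vanished, so would the slope of ['X], which is 1. *)
Lemma lebesgue_slope_gt0 z : 0 < lebesgue_slope z.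
Proof.
rewrite /lebesgue_slope sum_nodes lt_neqAle sumr_ge0 ?andbT // eq_sym.
apply/negP; rewrite psumr_eq0 // => /allP dL0.
have Xf : intercept_free n ('X : {poly R}) by rewrite /intercept_free size_polyX hornerX.
have := slope_interpolation z Xf; rewrite derivX hornerC big1 => [/eqP|i _].
  by rewrite oner_eq0.
by have := dL0 i (mem_index_enum _); rewrite /= normr_eq0 => /eqP ->; rewrite mulr0.
Qed.

Lemma omega_eq0 i z :
  omega n a i z = 0 <-> (lagrange_no_intercept n a i)^`().[z] = 0.
Proof.
rewrite /omega -/(lebesgue_slope z); split=> [/eqP|->]; last by rewrite normr0 mul0r.
by rewrite mulf_eq0 invr_eq0 (gt_eqF (lebesgue_slope_gt0 z)) orbF normr_eq0 => /eqP.
Qed.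

(** Markov's interlacing settles the signs of the [(P i)']. Passing to the Lagrange polynomials
    divides by the value of [P i] at [s i], which has the sign [(-1)^(n-i)] because [n-i] of the
    points lie above [s i]. *)
Lemma node_support_regionP z : node_support_region n a z <->
  exists tau, forall i, (0 < i <= n)%N ->
    0 < tau * ((-1) ^+ (n - i) * (lagrange_no_intercept n a i)^`().[z]).
Proof.
have [r rP] := choice (fun i => rolle_points (omit_increasing i s_incr)).
have dP i := deriv_prod_roots_factor (omit_increasing i s_incr) (rP i).
have rE i k : (0 < i <= n)%N -> (k < m)%N -> kth_root (omega n a i) k.+1 = r i k.
  move=> i_in; apply: kth_root_increasing => [|x]; first exact: (dP i).1.
  have nz : (P i).[s i]^-1 != 0.
    by rewrite invr_eq0 horner_omit_neq0 //; case/andP: i_in.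
  split=> [/omega_eq0|[l lm ->]]; last first.
    apply/omega_eq0; rewrite lagrange_no_interceptE // derivZ hornerZ.
    by rewrite /P (rP i l lm).2 mulr0.
  rewrite lagrange_no_interceptE // derivZ hornerZ /P (dP i).2 hornerZ.
  move/eqP; rewrite mulf_eq0 (negPf nz) mulf_eq0 pnatr_eq0 /=.
  rewrite horner_prod_roots_eq0 => /existsP[l /eqP ->].
  by exists l.
(* The [i]-th interval of the union corresponds to [k = i-1]; the infinite ends occur at [k = 0] and
   [k = m]. *)
have regionE : node_support_region n a z <-> exists k,
    [/\ (k <= m)%N, (0 < k)%N -> r 1%N k.-1 < z & (k < m)%N -> z < r n k].
  split=> [[[|k] //= kn /andP[lo hi]]|[k [km lo hi]]].
    exists k; split=> // [k0|km].
      move: lo; rewrite /omega_root (gtn_eqF k0) andbF.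
      rewrite [(1 == n)%N]eqSS eq_sym (gtn_eqF m0) /= lte_fin -[k]prednK //.
      by rewrite rE //; lia.
    move: hi; rewrite /omega_root eqSS andbF eqxx /= eqSS (ltn_eqF km) lte_fin.
    by rewrite rE //= /n ?leqnn.
  exists k.+1 => //=; apply/andP; split.
    rewrite /omega_root eqxx; case: (k) lo km => [|k'] lo km /=; first by rewrite ltNyr.
    rewrite [(1 == n)%N]eqSS eq_sym (gtn_eqF m0) /= lte_fin.
    by rewrite rE //; exact: lo.
  rewrite /omega_root andbF eqxx /= eqSS.
  case: eqVneq => [_|kneq]; first by rewrite ltry.
  have lt_km : (k < m)%N by rewrite ltn_neqAle kneq.
  by rewrite lte_fin rE ?hi //= /n ?leqnn.
apply: (iff_trans regionE); apply: (iff_trans (same_sign_region s_incr rP z)).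
have PL i : (0 < i <= n)%N -> exists2 b, 0 < b &
    (P i)^`().[z] = b * ((-1) ^+ (n - i) * (lagrange_no_intercept n a i)^`().[z]).
  move=> i_in; exists ((-1) ^+ (n - i) * (P i).[s i]).
    case/andP: i_in => i0 ilen; apply: sign_prod_roots_between => // j; last first.
      by move=> /andP[ij jn]; rewrite /omit /bump ij s_incr // add1n ltnS ij.
    by move=> ji; rewrite /omit /bump leqNgt ji s_incr // add0n ji.
  rewrite lagrange_no_interceptE // derivZ hornerZ.
  have nz : (P i).[s i] != 0 by rewrite horner_omit_neq0 //; case/andP: i_in.
  rewrite mulrACA -exprD addnn -mul2n exprM sqrrN expr1n expr1n mul1r.
  by rewrite mulrA divff ?mul1r.
split=> -[tau tauP]; exists tau => i i_in; have := tauP i i_in.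
  by have [b b0 ->] := PL i i_in; rewrite mulrCA pmulr_rgt0.
by have [b b0 ->] := PL i i_in => ?; rewrite mulrCA mulr_gt0.
Qed.

End Slope.

(** * Optimal designs *)
Section Optimality.
Variables (R : realType) (m : nat) (a z : R).
Let n := m.+1.
Hypotheses (m0 : (0 < m)%N) (a0 : 0 < a).
Implicit Types (p h : {poly R}) (xi : {fsfun R -> R with 0}).

Let dL i := (lagrange_no_intercept n a i)^`().[z].
Let D : R := lebesgue_slope m a z.
Let D0 : 0 < D. Proof. exact: lebesgue_slope_gt0. Qed.
Let DE : D = \sum_(i < n) `|dL i.+1|. Proof. exact: sum_nodes. Qed.
Let crit xi := c_criterion (slope_vector n z) xi.
Let nodes_in i : (0 < i <= n)%N -> 0 <= node n a i <= a.
Proof. exact: node_in. Qed.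

(** The weights [|dL i| / D] with the values [D sg (dL i)] at the nodes represent the slope
    functional for every [z]. The bound also makes the criterion of every optimal design finite. *)
Lemma omega_design_exists : exists xi, is_design a xi /\ (crit xi <= (D ^+ 2)%:E)%E.
Proof.
pose w (i : 'I_n) : R := `|dL i.+1| / D; pose g (i : 'I_n) : R := D * Num.sg (dL i.+1).
have w_sum : \sum_i w i = 1 by rewrite -mulr_suml -DE divff // gt_eqF.
have w0 i : 0 <= w i by rewrite divr_ge0 // ltW.
have [|//|//|p pf|xi [xi_des xi_crit]] :=
  @weighted_design R n a z 'I_n (fun i => node n a i.+1) w g.
- by move=> i; rewrite nodes_in // ltn_ord.
- rewrite (slope_interpolation a0 z pf); apply: eq_bigr => i _.
  rewrite -/(dL i.+1) /w /g [dL i.+1 in LHS]numEsg.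
  by field; rewrite gt_eqF.
exists xi; split=> //; apply: le_trans xi_crit _; rewrite lee_fin.
rewrite -[leRHS]mul1r -w_sum mulr_suml; apply: ler_sum => i _.
rewrite ler_wpM2l // exprMn ler_piMr ?sqr_ge0 // sqr_sg.
by case: (_ != 0); rewrite ?lexx ?ler01.
Qed.

Lemma sum_finsupp_nodes xi (F : R -> R) :
  (forall x, x \in finsupp xi -> exists2 i, (0 < i <= n)%N & x = node n a i) ->
  \sum_(x <- finsupp xi) xi x * F x =
  \sum_(i < n) xi (node n a i.+1) * F (node n a i.+1).
Proof.
move=> supp; pose X := [fset node n a (val i).+1 | i in 'I_n]%fset.
rewrite (big_fset_incl _ (B := X)) /=; first last.
- by move=> x _; rewrite memNfinsupp => /eqP ->; rewrite mul0r.
- apply/fsubsetP => x /supp[[|i] //= ilen ->].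
  by apply/imfsetP; exists (Ordinal ilen).
rewrite big_imfset /=; first by rewrite big_enum.
move=> i j _ _ /= e; apply/val_inj/eqP; case: (ltngtP (val i) (val j)) => // ij.
  suff : node n a i.+1 < node n a j.+1 by rewrite e ltxx.
  by apply: node_increasing => //; rewrite ltnS ij ltn_ord.
suff : node n a j.+1 < node n a i.+1 by rewrite e ltxx.
by apply: node_increasing => //; rewrite ltnS ij ltn_ord.
Qed.

(** Apply the representation to the Lagrange polynomial of the node [i]. *)
Lemma slope_weights xi h :
  (forall x, x \in finsupp xi -> exists2 i, (0 < i <= n)%N & x = node n a i) ->
  (forall p, intercept_free n p ->
     p^`().[z] = \sum_(x <- finsupp xi) xi x * (p.[x] * h.[x])) ->
  forall i, (0 < i <= n)%N -> dL i = xi (node n a i) * h.[node n a i].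
Proof.
move=> supp hE [|i] //= i_in; have Lf := @lagrange_intercept_free R m a i.+1 i_in.
rewrite /dL (hE _ Lf) (sum_finsupp_nodes _ supp) (bigD1 (Ordinal i_in)) //=.
rewrite lagrange_nodes // eqxx mul1r big1 ?addr0 // => j ji.
rewrite lagrange_nodes ?ltn_ord // eqSS eq_sym.
by move: ji; rewrite -val_eqE /= => /negPf ->; rewrite mul0r mulr0.
Qed.

Lemma extremal_polynomial : exists S, equioscillating n a 1 S /\
  forall i, (0 < i <= n)%N -> S.[node n a i] = (-1) ^+ (n - i).
Proof.
have [S [Sf S1 Sn]] := @shifted_chebyshev_exists R n a isT a0.
exists S; split; last by move=> i /andP[_ /Sn].
by split=> // i /andP[_ /Sn ->]; rewrite -exprM mulnC exprM sqrrN expr1n expr1n.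
Qed.

Lemma design_ge0 xi x : is_design a xi -> 0 <= xi x.
Proof.
case=> supp _; case: (finsuppP xi x) => [//|xx].
by have [_ /ltW] := supp x xx.
Qed.

Lemma alternating_lower_bound (tau : R) xi : tau ^+ 2 = 1 ->
  (forall i, (0 < i <= n)%N -> `|dL i| = tau * ((-1) ^+ (n - i) * dL i)) ->
  is_design a xi ->
  ((D ^+ 2)%:E <= crit xi)%E /\
  ((crit xi <= (D ^+ 2)%:E)%E ->
    (forall x, x \in finsupp xi -> exists2 i, (0 < i <= n)%N & x = node n a i) /\
    forall i, (0 < i <= n)%N -> xi (node n a i) = omega n a i z).
Proof.
move=> tau2 alt xi_des; have [fin|] := ltP (crit xi) +oo%E; last first.
  by rewrite leye_eq => /eqP ->; split=> //; rewrite leey.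
have [h [hf hE critE]] := finite_criterionP fin; rewrite /crit critE !lee_fin; set V := h^`().[z].
have [S [Seq Sn]] := extremal_polynomial; have [Sf S1 _] := Seq.
have [supp xi1] := xi_des.
(* By interpolation the slope of [S] is the alternating sum of the [dL i], that is [tau * D]. *)
have [k [k2 dS]] : exists k : R, k ^+ 2 = D ^+ 2 /\ S^`().[z] = k.
  exists (tau * D); split; first by rewrite exprMn tau2 mul1r.
  rewrite (slope_interpolation a0 z Sf) DE mulr_sumr; apply: eq_bigr => i _.
  have i_in : (0 < i.+1 <= n)%N by rewrite ltn_ord.
  by rewrite Sn // alt // mulrA -expr2 tau2 mul1r.
pose Q : R := \sum_(x <- finsupp xi) xi x * (h.[x] - k * S.[x]) ^+ 2.
pose W : R := \sum_(x <- finsupp xi) xi x * (1 - S.[x] ^+ 2).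
(* Expand [Q] using the integrals of [h^2], [S h] and 1, which are [V], [k] and 1; the term [k^2 W]
   makes up for [S^2 <= 1]. *)
have VE : V - D ^+ 2 = Q + k ^+ 2 * W.
  transitivity (\sum_(x <- finsupp xi) xi x * (h.[x] * h.[x]) -
    2 * k * (\sum_(x <- finsupp xi) xi x * (S.[x] * h.[x])) +
    k ^+ 2 * (\sum_(x <- finsupp xi) xi x)).
    by rewrite xi1 -(hE _ Sf) -(hE _ hf) dS -k2 /V; ring.
  rewrite /Q /W !mulr_sumr -sumrB -!big_split; apply: eq_bigr => x _ /=; ring.
have Q0 x : x \in finsupp xi -> 0 <= xi x * (h.[x] - k * S.[x]) ^+ 2.
  by move=> _; rewrite mulr_ge0 ?sqr_ge0 // (design_ge0 _ xi_des).
have W0 x : x \in finsupp xi -> 0 <= xi x * (1 - S.[x] ^+ 2).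
  by move=> /supp[x_in xi_gt0]; rewrite mulr_ge0 ?(ltW xi_gt0) ?subr_ge0 ?S1.
have Qge : 0 <= Q by rewrite /Q big_seq sumr_ge0.
have Wge : 0 <= W by rewrite /W big_seq sumr_ge0.
have kW : 0 <= k ^+ 2 * W by rewrite mulr_ge0 ?sqr_ge0.
split=> [|VD]; first by rewrite -subr_ge0 VE addr_ge0.
have /eqP Q_0 : Q == 0 by rewrite eq_le Qge andbT; lra.
have {kW}/eqP : k ^+ 2 * W == 0 by rewrite eq_le kW andbT; lra.
move/eqP; rewrite k2 mulf_eq0 expf_eq0 (gt_eqF D0) /= => /eqP W_0.
have h_S x : x \in finsupp xi -> h.[x] = k * S.[x] /\ S.[x] ^+ 2 = 1.
  move=> xx; have [_ xi_gt0] := supp x xx.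
  have cancel_xi (y : R) : xi x * y == 0 -> y = 0.
    by rewrite mulf_eq0 (gt_eqF xi_gt0) => /eqP.
  split.
    move: Q_0 => /eqP; rewrite /Q big_seq psumr_eq0 // => /allP/(_ x xx).
    by rewrite xx => /cancel_xi/eqP; rewrite sqrf_eq0 subr_eq0 => /eqP.
  move: W_0 => /eqP; rewrite /W big_seq psumr_eq0 // => /allP/(_ x xx).
  by rewrite xx => /cancel_xi/eqP; rewrite subr_eq0 => /eqP.
have supp_nodes x : x \in finsupp xi -> exists2 i, (0 < i <= n)%N & x = node n a i.
  move=> xx; have [x_in _] := supp x xx; have [_ Sx] := h_S x xx.
  exact: equioscillating_extremal ltr01 Seq x_in Sx.
split=> // i i_in; rewrite /omega -/(lebesgue_slope m a z) -/D -/(dL i).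
rewrite (slope_weights supp_nodes hE i_in) normrM ger0_norm ?(design_ge0 _ xi_des) //.
(* At a node outside the support both sides vanish; on the support [|h| = D]. *)
case: (finsuppP xi (node n a i)) => [|xx]; first by rewrite !mul0r.
have [-> Sx] := h_S _ xx; rewrite normrM.
have norm_of_sqr (x y : R) : 0 <= y -> x ^+ 2 = y ^+ 2 -> `|x| = y.
  by move=> y0 xy; apply/eqP; rewrite -(@eqrXn2 _ 2) // real_normK ?num_real // xy.
rewrite (norm_of_sqr k D) ?ltW // (norm_of_sqr _ 1) ?ler01 ?expr1n //.
by rewrite mulr1 mulfK // gt_eqF.
Qed.

Lemma perturbation_bound (V y K : R) :
  (forall t, 0 < t < 1 -> 0 <= V - y ^+ 2 + t * K) -> y ^+ 2 <= V.
Proof.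
move=> tP; rewrite -subr_ge0 leNgt; apply/negP => neg.
pose d : R := - (V - y ^+ 2); have d0 : 0 < d by rewrite /d oppr_gt0.
have K0 : 0 <= `|K| by [].
(* [t = d / b] is below 1 and keeps [t |K|] below the excess [d] of [y^2] over [V]. *)
pose b : R := 2 * (`|K| + 1 + d); have b0 : 0 < b by rewrite /b; lra.
have : 0 < d / b < 1 by rewrite divr_gt0 //= ltr_pdivrMr // /b; lra.
move/tP; rewrite leNgt => /negP; apply.
have : d / b * K <= d / b * `|K| by rewrite ler_wpM2l ?ler_norm // divr_ge0 ?ltW.
have : d / b * `|K| < d by rewrite mulrAC ltr_pdivrMr // ltr_pM2l // /b; lra.
by rewrite /d; lra.
Qed.

Lemma node_support_gt0 xi : is_design a xi ->
  [set` finsupp xi] = [set node n a i | i in [set i : nat | (1 <= i <= n)%N]] ->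
  forall i, (0 < i <= n)%N -> 0 < xi (node n a i).
Proof.
move=> xi_des supp i i_in.
have : [set` finsupp xi] (node n a i) by rewrite supp; exists i.
by move=> /= /(xi_des.1)[].
Qed.

(* The last clause is the equivalence theorem of optimal design: it expresses that
   moving mass [t] from [xi] to [x] cannot decrease the criterion, as [t] tends
   to 0. *)
Lemma optimal_design_bound xi : slope_optimal n a z xi ->
  [set` finsupp xi] = [set node n a i | i in [set i : nat | (1 <= i <= n)%N]] ->
  exists h, [/\ intercept_free n h,
    forall i, (0 < i <= n)%N -> dL i = xi (node n a i) * h.[node n a i],
    h^`().[z] = \sum_(i < n) xi (node n a i.+1) * h.[node n a i.+1] ^+ 2,
    \sum_(i < n) xi (node n a i.+1) = 1
    & forall x, 0 <= x <= a -> h.[x] ^+ 2 <= h^`().[z]].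
Proof.
move=> [xi_des xi_opt] supp.
have supp_nodes x : x \in finsupp xi -> exists2 i, (0 < i <= n)%N & x = node n a i.
  move=> xx; have : [set` finsupp xi] x by [].
  by rewrite supp => -[i /= i_in <-]; exists i.
have xi_gt0 := node_support_gt0 xi_des supp.
have fin : (crit xi < +oo)%E.
  have [eta [eta_des eta_crit]] := omega_design_exists.
  by apply: le_lt_trans (ltry (D ^+ 2)); apply: le_trans eta_crit; exact: xi_opt.
have [h [hf hE critE]] := finite_criterionP fin.
have dLE := slope_weights supp_nodes hE.
have w_sum : \sum_(i < n) xi (node n a i.+1) = 1.
  have := xi_des.2; under eq_bigr do rewrite -[xi _]mulr1.
  by rewrite (sum_finsupp_nodes (fun=> 1) supp_nodes); under eq_bigr do rewrite mulr1.
exists h; split=> //.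
  by rewrite (hE _ hf) (sum_finsupp_nodes _ supp_nodes).
have VE : h^`().[z] = \sum_(i < n) xi (node n a i.+1) * h.[node n a i.+1] ^+ 2.
  by rewrite (hE _ hf) (sum_finsupp_nodes _ supp_nodes).
set V : R := h^`().[z] in critE VE *.
move=> x x_in; pose L (i : 'I_n) : R := (lagrange_no_intercept n a i.+1).[x].
pose w (i : 'I_n) := xi (node n a i.+1); pose hn (i : 'I_n) : R := h.[node n a i.+1].
have w0 i : 0 < w i by apply: xi_gt0; rewrite ltn_ord.
pose y : R := h.[x]; pose K : R := \sum_i L i ^+ 2 / w i.
(* The bound for the perturbed design exceeds [V] by [t / (1 - t)] times
   [V - y^2 + t y^2 (K - 1)]. *)
apply: (@perturbation_bound _ _ (y ^+ 2 * (K - 1))) => t /andP[t0 t1].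
have t1' : 0 < 1 - t by rewrite subr_gt0.
(* The nodes keep the fraction [1 - t] of their mass and the extra point [x], which may be a node,
   receives [t]. The value [y] of [h] is used at [x], and [g] is corrected at the nodes through the
   interpolation formula [pE] so that the slope functional is still represented. *)
pose pt (i : 'I_n + unit) : R := if i is inl i then node n a i.+1 else x.
pose wt (i : 'I_n + unit) : R := if i is inl i then (1 - t) * w i else t.
pose g (i : 'I_n + unit) : R :=
  if i is inl i then (hn i * w i - t * y * L i) / ((1 - t) * w i) else y.
have big_unit (F : unit -> R) : \sum_i F i = F tt.
  by rewrite (big_pred1 tt) // => -[].
have pE p : intercept_free n p -> p.[x] = \sum_i p.[node n a (val i).+1] * L i.
  by move=> pf; rewrite [LHS](value_interpolation a0 x pf).
have [|||p pf|eta [eta_des eta_crit]] := @weighted_design R n a z _ pt wt g.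
- by case=> [i|u]; rewrite /pt // nodes_in // ltn_ord.
- by case=> [i|u]; rewrite /wt ?ltW // mulr_gt0.
- by rewrite big_sumType big_unit /= -mulr_sumr w_sum; ring.
- rewrite big_sumType big_unit /= (pE p pf) (slope_interpolation a0 z pf).
  rewrite !mulr_suml mulr_sumr -big_split; apply: eq_bigr => i _ /=.
  rewrite -/(dL i.+1) dLE ?ltn_ord // -/(w i) -/(hn i).
  by field; rewrite !gt_eqF.
have : V <= \sum_i wt i * g i ^+ 2.
  by rewrite -lee_fin -critE; apply: le_trans eta_crit; exact: xi_opt.
rewrite big_sumType big_unit /=.
have -> : \sum_(i < n) (1 - t) * w i * ((hn i * w i - t * y * L i) / ((1 - t) * w i)) ^+ 2
    = (V - 2 * t * y * (\sum_i hn i * L i) + t ^+ 2 * y ^+ 2 * K) / (1 - t).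
  rewrite VE /K !mulr_sumr -sumrB -big_split mulr_suml.
  by apply: eq_bigr => i _ /=; rewrite -/(w i) -/(hn i); field; rewrite !gt_eqF.
rewrite -(pE h hf) -/y -lerBlDr ler_pdivlMr // => le_V.
rewrite -(pmulr_rge0 _ t0); lra.
Qed.

Lemma node_supported_optimal_alternates xi : slope_optimal n a z xi ->
  [set` finsupp xi] = [set node n a i | i in [set i : nat | (1 <= i <= n)%N]] ->
  exists tau, forall i, (0 < i <= n)%N -> 0 < tau * ((-1) ^+ (n - i) * dL i).
Proof.
move=> xi_opt supp; have [h [hf dLE VE w_sum hV]] := optimal_design_bound xi_opt supp.
set V : R := h^`().[z] in VE hV.
have xi_gt0 := node_support_gt0 xi_opt.1 supp.
have V0 : 0 < V.
  rewrite lt_neqAle eq_sym (le_trans (sqr_ge0 _) (hV a _)) ?lexx ?ltW //= ?andbT.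
  (* If [V = 0], then [h] vanishes at the nodes and so do all the [dL i], against [D > 0]. *)
  apply: contraTneq D0 => V_0; rewrite DE big1 ?ltxx // => i _.
  have i_in : (0 < i.+1 <= n)%N by rewrite ltn_ord.
  have := hV _ (nodes_in i_in); rewrite V_0 => h0.
  have /eqP : h.[node n a i.+1] ^+ 2 == 0 by rewrite eq_le h0 sqr_ge0.
  by move/eqP; rewrite sqrf_eq0 dLE // => /eqP ->; rewrite mulr0 normr0.
have h_nodes i : (0 < i <= n)%N -> h.[node n a i] ^+ 2 = V.
  case: i => [|i] // i_in; have := i_in; rewrite /= => ilen.
  have gap_ge0 (j : 'I_n) : 0 <= xi (node n a j.+1) * (V - h.[node n a j.+1] ^+ 2).
    have j_in : (0 < j.+1 <= n)%N by rewrite ltn_ord.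
    by rewrite mulr_ge0 ?(ltW (xi_gt0 _ j_in)) // subr_ge0 hV // nodes_in.
  (* The weighted mean of [V - h^2] over the nodes is 0 and no term is negative. *)
  have : \sum_(j < n) xi (node n a j.+1) * (V - h.[node n a j.+1] ^+ 2) == 0.
    under eq_bigr do rewrite mulrBr.
    by rewrite sumrB -VE -mulr_suml w_sum mul1r subrr.
  rewrite psumr_eq0 // => /allP/(_ (Ordinal ilen) (mem_index_enum _)) /=.
  by rewrite mulf_eq0 (gt_eqF (xi_gt0 _ i_in)) subr_eq0 => /eqP.
have [S [Seq Sn]] := extremal_polynomial.
have heq : equioscillating n a V h by [].
have [b hb] := equioscillating_proportional (ltn0Sn m) a0 V0 ltr01 heq Seq.
(* The factor in [h = b S] serves as [tau]: it turns the expression into the weight times [h^2]. *)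
exists b => i i_in; rewrite dLE // -(Sn i i_in).
have -> : b * (S.[node n a i] * (xi (node n a i) * h.[node n a i])) =
          xi (node n a i) * h.[node n a i] ^+ 2 by rewrite hb hornerZ; ring.
by rewrite h_nodes // mulr_gt0 // xi_gt0.
Qed.

(** Replacing [t] by its sign turns the inequalities into the identities required for the lower
    bound. *)
Lemma sign_pattern (t : R) : (forall i, (0 < i <= n)%N -> 0 < t * ((-1) ^+ (n - i) * dL i)) ->
  exists2 tau : R, tau ^+ 2 = 1 &
    forall i, (0 < i <= n)%N -> `|dL i| = tau * ((-1) ^+ (n - i) * dL i).
Proof.
move=> tP; have t_neq0 : t != 0.
  have n_in : (0 < n <= n)%N by rewrite /= leqnn.
  by apply: contraTneq (tP n n_in) => ->; rewrite mul0r ltxx.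
exists (Num.sg t) => [|i i_in]; first by rewrite sqr_sg t_neq0.
set X := _ * dL i; have -> : `|dL i| = `|X|.
  by rewrite normrM normrX normrN1 expr1n mul1r.
have := gtr0_sg (tP i i_in); rewrite sgrM -/X normrEsg => tX.
congr (_ * _); rewrite -[LHS]mul1r -(_ : Num.sg t ^+ 2 = 1); last by rewrite sqr_sg t_neq0.
by rewrite expr2 -mulrA tX mulr1.
Qed.
End Optimality.

Theorem theorem3p1 (R : realType) (n : nat) (a z : R)
    (hn : (1 < n)%N) (ha : 0 < a) :
  [/\ forall xi : {fsfun R -> R with 0}, slope_optimal n a z xi ->
        ([set` finsupp xi] = [set node n a i | i in [set i : nat | (1 <= i <= n)%N]]
         <-> node_support_region n a z),
      node_support_region n a z ->
        exists xi : {fsfun R -> R with 0}, slope_optimal n a z xi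
    & node_support_region n a z ->
        forall xi : {fsfun R -> R with 0}, slope_optimal n a z xi ->
        forall i : nat, (1 <= i <= n)%N -> xi (node n a i) = omega n a i z].
Proof.
case: n hn => [|m] // m0; set n := m.+1; pose D := lebesgue_slope m a z.
have [xi0 [xi0_des xi0_crit]] := omega_design_exists m z ha.
have region_bound : node_support_region n a z -> forall xi, is_design a xi ->
    ((D ^+ 2)%:E <= c_criterion (slope_vector n z) xi)%E /\
    ((c_criterion (slope_vector n z) xi <= (D ^+ 2)%:E)%E ->
      (forall x, x \in finsupp xi -> exists2 i, (0 < i <= n)%N & x = node n a i) /\
      forall i, (0 < i <= n)%N -> xi (node n a i) = omega n a i z).
  move=> /(node_support_regionP m0 ha)[t tP] xi xi_des.
  have [tau tau2 alt] := sign_pattern tP.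
  exact: alternating_lower_bound tau2 alt xi_des.
have region_opt : node_support_region n a z -> forall xi, slope_optimal n a z xi ->
    (forall x, x \in finsupp xi -> exists2 i, (0 < i <= n)%N & x = node n a i) /\
    forall i, (0 < i <= n)%N -> xi (node n a i) = omega n a i z.
  move=> zr xi [xi_des xi_opt]; apply: (region_bound zr xi xi_des).2.
  by apply: le_trans (xi_opt _ xi0_des) xi0_crit.
split=> [xi xi_opt|zr|zr xi xi_opt]; last exact: (region_opt zr xi xi_opt).2.
  split=> [supp|zr].
    by apply/(node_support_regionP m0 ha); apply: node_supported_optimal_alternates xi_opt supp.
  have [supp w] := region_opt zr xi xi_opt.
  apply/seteqP; split=> x /=; first by case/supp => i i_in ->; exists i.
  (* For [z] in the region no Lagrange slope vanishes, so every node has nonzero weight. *)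
  move=> [i i_in <-]; rewrite mem_finsupp w //; apply/eqP.
  have /(node_support_regionP m0 ha)[t /(_ i i_in)] := zr.
  by move=> t_gt0 /(omega_eq0 m ha) dL0; move: t_gt0; rewrite dL0 !mulr0 ltxx.
(* [xi0] attains the lower bound [D^2] valid in the region. *)
exists xi0; split=> // eta eta_des.
by apply: le_trans xi0_crit _; exact: (region_bound zr eta eta_des).1.
Qed.
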